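(* Let $\mathcal{C},\mathcal{D}$ be pivotal dagger 2-categories and let $\alpha:F\to G$ be a pseudonatural transformation between unitary pseudofunctors $F,G:\mathcal{C}\to\mathcal{D}$. The following are equivalent: (i) There is an equality of pseudonatural transformations $\alpha^*=\alpha^\dagger$. (ii) For all 1-morphisms $X:r\to s$ in $\mathcal{C}$, the component $\alpha_X:F(X)\otimes\alpha_s\to\alpha_r\otimes G(X)$ is unitary.
   Context: All 2-categories are taken to be strict. 1-morphisms compose from left to right: for $X:r\to s$ and $Y:s\to t$ the composite is $X\otimes Y:r\to t$; $\otimes$ also denotes horizontal composition of 2-morphisms, and $\circ$ vertical composition. A pseudofunctor $F:\mathcal{C}\to\mathcal{D}$ consists of an assignment on objects, functors $\mathcal{C}(r,s)\to\mathcal{D}(F(r),F(s))$, and invertible 2-morphisms $m^F_{X,Y}:F(X)\otimes F(Y)\to F(X\otimes Y)$, $u^F_r:\mathrm{id}_{F(r)}\to F(\mathrm{id}_r)$ satisfying the usual naturality, associativity and unitality conditions. A pseudonatural transformation $\alpha:F\to G$ consists of 1-morphisms $\alpha_r:F(r)\to G(r)$ and invertible 2-morphisms $\alpha_X:F(X)\otimes\alpha_s\to\alpha_r\otimes G(X)$ for $X:r\to s$, such that $(\mathrm{id}_{\alpha_r}\otimes G(f))\circ\alpha_X=\alpha_Y\circ(F(f)\otimes\mathrm{id}_{\alpha_s})$ for all $f:X\to Y$; $\alpha_{X\otimes Y}\circ(m^F_{X,Y}\otimes\mathrm{id}_{\alpha_t})=(\mathrm{id}_{\alpha_r}\otimes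 m^G_{X,Y})\circ(\alpha_X\otimes\mathrm{id}_{G(Y)})\circ(\mathrm{id}_{F(X)}\otimes\alpha_Y)$; and $\alpha_{\mathrm{id}_r}\circ(u^F_r\otimes\mathrm{id}_{\alpha_r})=\mathrm{id}_{\alpha_r}\otimes u^G_r$. It is an invertible icon if $F(r)=G(r)$ and $\alpha_r=\mathrm{id}_{F(r)}$ for all $r$. A right dual of $X:r\to s$ is $[X^*,\eta_X,\epsilon_X]$ with $X^*:s\to r$, $\eta_X:\mathrm{id}_s\to X^*\otimes X$, $\epsilon_X:X\otimes X^*\to\mathrm{id}_r$ satisfying the snake equations; a left dual is $[{}^*X,\eta,\epsilon]$ with $\eta:\mathrm{id}_r\to X\otimes{}^*X$, $\epsilon:{}^*X\otimes X\to\mathrm{id}_s$ satisfying the snake equations. The right transpose of $f:X\to Y$ is $f^*=(\mathrm{id}_{X^*}\otimes\epsilon_Y)\circ(\mathrm{id}_{X^*}\otimes f\otimes\mathrm{id}_{Y^*})\circ(\eta_X\otimes\mathrm{id}_{Y^*}):Y^*\to X^*$. A 2-category with chosen right duals is pivotal if it is equipped with an invertible icon $\iota$ from the double duals pseudofunctor ($X\mapsto X^{**}$, $f\mapsto f^{**}$, identity on objects, with canonical multiplicators and unitors from uniqueness of duals) to the identity pseudofunctor. Then $X^*$ is also a left dual of $X$, with cup $(\iota_X\otimes\mathrm{id}_{X^*})\circ\eta_{X^*}:\mathrm{id}_r\to X\otimes X^*$ and cap $\epsilon_{X^*}\circ(\mathrm{id}_{X^*}\otimes\iota_X^{-1}):X^*\otimes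 X\to\mathrm{id}_s$; these are the chosen left duals. A dagger 2-category is a 2-category with contravariant identity-on-objects involutive functors $\dagger$ on each hom-category, satisfying $(\alpha\otimes\beta)^\dagger=\alpha^\dagger\otimes\beta^\dagger$. A 2-morphism $\alpha:X\to Y$ is unitary if $\alpha^\dagger\circ\alpha=\mathrm{id}_X$ and $\alpha\circ\alpha^\dagger=\mathrm{id}_Y$. A pivotal dagger 2-category is a pivotal 2-category which is also a dagger 2-category such that for all $X$ the left cup and cap above equal $\epsilon_X^\dagger$ and $\eta_X^\dagger$ respectively. A pseudofunctor $F$ between dagger 2-categories is unitary if $F(f^\dagger)=F(f)^\dagger$ for all 2-morphisms $f$ and all $m^F_{X,Y}$, $u^F_r$ are unitary. The right dual $\alpha^*:G\to F$ of $\alpha$ in the 2-category of pseudofunctors: $(\alpha^* )_r=(\alpha_r)^*$ and, for $X:r\to s$, $(\alpha^* )_X:G(X)\otimes\alpha_s^*\to\alpha_r^*\otimes F(X)$ is the right transpose of $\alpha_{{}^*X}:F({}^*X)\otimes\alpha_r\to\alpha_s\otimes G({}^*X)$, using the chosen left dual ${}^*X$ of $X$ in $\mathcal{C}$ and the right dualities $\alpha_r^*$, $\alpha_s^*$, $F(X)$ (right dual to $F({}^*X)$) and $G(X)$ (right dual to $G({}^*X)$), where the latter two are induced by applying $F$, $G$ (with multiplicators and unitors) to the cup and cap exhibiting ${}^*X$ as left dual of $X$. The dagger $\alpha^\dagger:G\to F$ of $\alpha$: $(\alpha^\dagger)_r=(\alpha_r)^*$ and, for $X:r\to s$, $(\alpha^\dagger)_X=(\mathrm{id}_{\alpha_r^*}\otimes\mathrm{id}_{F(X)}\otimes\epsilon_{\alpha_s})\circ(\mathrm{id}_{\alpha_r^*}\otimes(\alpha_X)^\dagger\otimes\mathrm{id}_{\alpha_s^*})\circ(\eta_{\alpha_r}\otimes\mathrm{id}_{G(X)}\otimes\mathrm{id}_{\alpha_s^*}):G(X)\otimes\alpha_s^*\to\alpha_r^*\otimes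 F(X)$. *)

(* Defs.v *)
Set Implicit Arguments.
Unset Strict Implicit.
Unset Printing Implicit Defensive.

Declare Scope twocat_scope.
Delimit Scope twocat_scope with twocat.
Open Scope twocat_scope.

Reserved Notation "X ⇒ Y" (at level 70, no associativity).
Reserved Notation "X ⊗ Y" (at level 42, right associativity).
Reserved Notation "f ⊠ g" (at level 42, right associativity).
Reserved Notation "g ∘ f" (at level 50, left associativity).
Reserved Notation "f '^†'" (at level 1, format "f '^†'").

                            

Record twocat_data := {
  ob :> Type;
  mor : ob -> ob -> Type;
  cell : forall r s : ob, mor r s -> mor r s -> Type;
  id1 : forall r : ob, mor r r;
  comp1 : forall r s t : ob, mor r s -> mor s t -> mor r t;
  id2 : forall (r s : ob) (X : mor r s), cell X X;
  vcomp : forall (r s : ob) (X Y Z : mor r s), cell Y Z -> cell X Y -> cell X Z;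
  hcomp : forall (r s t : ob) (X X' : mor r s) (Y Y' : mor s t),
    cell X X' -> cell Y Y' -> cell (comp1 X Y) (comp1 X' Y')
}.

Arguments id1 {_} r.
Arguments id2 {_ r s} X.

                                                                            
                                                                
Notation "X ⇒ Y" := (cell X Y) : twocat_scope.
Notation "X ⊗ Y" := (comp1 X Y) : twocat_scope.
Notation "f ⊠ g" := (hcomp f g) : twocat_scope.
Notation "g ∘ f" := (vcomp g f) : twocat_scope.

                                                                               
                                                                             
                                                           
Definition idcell (C : twocat_data) (r s : C) (X Y : mor r s) (e : X = Y) : X ⇒ Y :=
  match e in (_ = Z) return X ⇒ Z with eq_refl => id2 X end.

                                                                        
                                                                           
                                                                       
                                                   
Record twocat := {
  twocat_base :> twocat_data;
  comp1A : forall (r s t u : twocat_base) (X : mor r s) (Y : mor s t) (Z : mor t u),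
    (X ⊗ Y) ⊗ Z = X ⊗ (Y ⊗ Z);
  comp1_idl : forall (r s : twocat_base) (X : mor r s), id1 r ⊗ X = X;
  comp1_idr : forall (r s : twocat_base) (X : mor r s), X ⊗ id1 s = X;
  vcompA : forall (r s : twocat_base) (W X Y Z : mor r s)
      (h : Y ⇒ Z) (g : X ⇒ Y) (f : W ⇒ X),
    h ∘ (g ∘ f) = (h ∘ g) ∘ f;
  vcomp_idl : forall (r s : twocat_base) (X Y : mor r s) (f : X ⇒ Y), id2 Y ∘ f = f;
  vcomp_idr : forall (r s : twocat_base) (X Y : mor r s) (f : X ⇒ Y), f ∘ id2 X = f;
  hcomp_id2 : forall (r s t : twocat_base) (X : mor r s) (Y : mor s t),
    id2 X ⊠ id2 Y = id2 (X ⊗ Y);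
  interchange : forall (r s t : twocat_base) (X X' X'' : mor r s) (Y Y' Y'' : mor s t)
      (f' : X' ⇒ X'') (f : X ⇒ X') (g' : Y' ⇒ Y'') (g : Y ⇒ Y'),
    (f' ∘ f) ⊠ (g' ∘ g) = (f' ⊠ g') ∘ (f ⊠ g);
  hcompA : forall (r s t u : twocat_base) (X X' : mor r s) (Y Y' : mor s t) (Z Z' : mor t u)
      (f : X ⇒ X') (g : Y ⇒ Y') (h : Z ⇒ Z'),
    idcell (comp1A X' Y' Z') ∘ ((f ⊠ g) ⊠ h)
    = (f ⊠ (g ⊠ h)) ∘ idcell (comp1A X Y Z);
  hcomp_idl : forall (r s : twocat_base) (X Y : mor r s) (f : X ⇒ Y),
    idcell (comp1_idl Y) ∘ (id2 (id1 r) ⊠ f) = f ∘ idcell (comp1_idl X);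
  hcomp_idr : forall (r s : twocat_base) (X Y : mor r s) (f : X ⇒ Y),
    idcell (comp1_idr Y) ∘ (f ⊠ id2 (id1 s)) = f ∘ idcell (comp1_idr X)
}.

Section Identities.
Variable C : twocat.

Definition as_ (r s t u : C) (X : mor r s) (Y : mor s t) (Z : mor t u) :
    (X ⊗ Y) ⊗ Z ⇒ X ⊗ (Y ⊗ Z) :=
  idcell (comp1A X Y Z).
Definition asV (r s t u : C) (X : mor r s) (Y : mor s t) (Z : mor t u) :
    X ⊗ (Y ⊗ Z) ⇒ (X ⊗ Y) ⊗ Z :=
  idcell (eq_sym (comp1A X Y Z)).
Definition lu (r s : C) (X : mor r s) : id1 r ⊗ X ⇒ X := idcell (comp1_idl X).
Definition luV (r s : C) (X : mor r s) : X ⇒ id1 r ⊗ X := idcell (eq_sym (comp1_idl X)).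
Definition ru (r s : C) (X : mor r s) : X ⊗ id1 s ⇒ X := idcell (comp1_idr X).
Definition ruV (r s : C) (X : mor r s) : X ⇒ X ⊗ id1 s := idcell (eq_sym (comp1_idr X)).

Definition inverse2 (r s : C) (X Y : mor r s) (f : X ⇒ Y) (g : Y ⇒ X) : Prop :=
  g ∘ f = id2 X /\ f ∘ g = id2 Y.

End Identities.

                       

Record pfun_data (C D : twocat) := {
  pf_ob :> C -> D;
  pf_mor : forall r s : C, mor r s -> mor (pf_ob r) (pf_ob s);
  pf_cell : forall (r s : C) (X Y : mor r s), X ⇒ Y -> pf_mor X ⇒ pf_mor Y;
  pf_m : forall (r s t : C) (X : mor r s) (Y : mor s t),
    pf_mor X ⊗ pf_mor Y ⇒ pf_mor (X ⊗ Y);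
  pf_mV : forall (r s t : C) (X : mor r s) (Y : mor s t),
    pf_mor (X ⊗ Y) ⇒ pf_mor X ⊗ pf_mor Y;
  pf_u : forall r : C, id1 (pf_ob r) ⇒ pf_mor (id1 r);
  pf_uV : forall r : C, pf_mor (id1 r) ⇒ id1 (pf_ob r)
}.

Arguments pf_mor {C D} p {r s} X.
Arguments pf_cell {C D} p {r s X Y} f.
Arguments pf_m {C D} p {r s t} X Y.
Arguments pf_mV {C D} p {r s t} X Y.
Arguments pf_u {C D} p r.
Arguments pf_uV {C D} p r.

Record is_pseudofunctor (C D : twocat) (F : pfun_data C D) : Prop := {
  pf_id2 : forall (r s : C) (X : mor r s), pf_cell F (id2 X) = id2 (pf_mor F X);
  pf_vcomp : forall (r s : C) (X Y Z : mor r s) (g : Y ⇒ Z) (f : X ⇒ Y),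
    pf_cell F (g ∘ f) = pf_cell F g ∘ pf_cell F f;
  pf_m_inv : forall (r s t : C) (X : mor r s) (Y : mor s t),
    inverse2 (pf_m F X Y) (pf_mV F X Y);
  pf_u_inv : forall r : C, inverse2 (pf_u F r) (pf_uV F r);
  pf_m_nat : forall (r s t : C) (X X' : mor r s) (Y Y' : mor s t) (f : X ⇒ X') (g : Y ⇒ Y'),
    pf_m F X' Y' ∘ (pf_cell F f ⊠ pf_cell F g) = pf_cell F (f ⊠ g) ∘ pf_m F X Y;
  pf_assoc : forall (r s t v : C) (X : mor r s) (Y : mor s t) (Z : mor t v),
    pf_cell F (as_ X Y Z) ∘ pf_m F (X ⊗ Y) Z ∘ (pf_m F X Y ⊠ id2 (pf_mor F Z))
    = pf_m F X (Y ⊗ Z) ∘ (id2 (pf_mor F X) ⊠ pf_m F Y Z)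
      ∘ as_ (pf_mor F X) (pf_mor F Y) (pf_mor F Z);
  pf_unitl : forall (r s : C) (X : mor r s),
    pf_cell F (lu X) ∘ pf_m F (id1 r) X ∘ (pf_u F r ⊠ id2 (pf_mor F X)) = lu (pf_mor F X);
  pf_unitr : forall (r s : C) (X : mor r s),
    pf_cell F (ru X) ∘ pf_m F X (id1 s) ∘ (id2 (pf_mor F X) ⊠ pf_u F s) = ru (pf_mor F X)
}.

Record pseudofunctor (C D : twocat) := {
  pseudofunctor_data :> pfun_data C D;
  pseudofunctorP : is_pseudofunctor pseudofunctor_data
}.

Definition id_pfun (C : twocat) : pfun_data C C := {|
  pf_ob := fun r => r;
  pf_mor := fun r s X => X;
  pf_cell := fun r s X Y f => f;
  pf_m := fun r s t X Y => id2 (X ⊗ Y);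
  pf_mV := fun r s t X Y => id2 (X ⊗ Y);
  pf_u := fun r => id2 (id1 r);
  pf_uV := fun r => id2 (id1 r)
|}.

                                      

                                                                              
                                             
Record ptrans_data (C D : twocat) (F G : pfun_data C D) := {
  pt_mor :> forall r : C, mor (F r) (G r);
  pt_cell : forall (r s : C) (X : mor r s),
    pf_mor F X ⊗ pt_mor s ⇒ pt_mor r ⊗ pf_mor G X
}.

Arguments pt_cell {C D F G} p {r s} X.

Record is_pseudonatural (C D : twocat) (F G : pfun_data C D) (a : ptrans_data F G) : Prop := {
  pt_inv : forall (r s : C) (X : mor r s), exists g, inverse2 (pt_cell a X) g;
  pt_nat : forall (r s : C) (X Y : mor r s) (f : X ⇒ Y),
    (id2 (a r) ⊠ pf_cell G f) ∘ pt_cell a X = pt_cell a Y ∘ (pf_cell F f ⊠ id2 (a s));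
  pt_mult : forall (r s t : C) (X : mor r s) (Y : mor s t),
    pt_cell a (X ⊗ Y) ∘ (pf_m F X Y ⊠ id2 (a t))
    = (id2 (a r) ⊠ pf_m G X Y)
      ∘ as_ (a r) (pf_mor G X) (pf_mor G Y)
      ∘ (pt_cell a X ⊠ id2 (pf_mor G Y))
      ∘ asV (pf_mor F X) (a s) (pf_mor G Y)
      ∘ (id2 (pf_mor F X) ⊠ pt_cell a Y)
      ∘ as_ (pf_mor F X) (pf_mor F Y) (a t);
  pt_unit : forall r : C,
    pt_cell a (id1 r) ∘ (pf_u F r ⊠ id2 (a r))
    = (id2 (a r) ⊠ pf_u G r) ∘ ruV (a r) ∘ lu (a r)
}.

Record pseudonatural (C D : twocat) (F G : pfun_data C D) := {
  pseudonatural_data :> ptrans_data F G;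
  pseudonaturalP : is_pseudonatural pseudonatural_data
}.

              

Record rdual_data (C : twocat) (r s : C) (X : mor r s) := {
  rd_ob :> mor s r;
  rd_cup : id1 s ⇒ rd_ob ⊗ X;
  rd_cap : X ⊗ rd_ob ⇒ id1 r
}.

Record is_rdual (C : twocat) (r s : C) (X : mor r s) (d : rdual_data X) : Prop := {
  rd_snake : lu X ∘ (rd_cap d ⊠ id2 X) ∘ asV X d X ∘ (id2 X ⊠ rd_cup d) ∘ ruV X = id2 X;
  rd_snake_dual :
    ru d ∘ (id2 (rd_ob d) ⊠ rd_cap d) ∘ as_ (rd_ob d) X (rd_ob d)
      ∘ (rd_cup d ⊠ id2 (rd_ob d)) ∘ luV d
    = id2 (rd_ob d)
}.

Record ldual_data (C : twocat) (r s : C) (X : mor r s) := {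
  ld_ob :> mor s r;
  ld_cup : id1 r ⇒ X ⊗ ld_ob;
  ld_cap : ld_ob ⊗ X ⇒ id1 s
}.

Section Duals.
Variable C : twocat.

                                                      
Definition comp_rdual (r s t : C) (X : mor r s) (Y : mor s t)
    (dX : rdual_data X) (dY : rdual_data Y) : rdual_data (X ⊗ Y) := {|
  rd_ob := dY ⊗ dX;
  rd_cup := asV dY dX (X ⊗ Y) ∘ (id2 (rd_ob dY) ⊠ as_ dX X Y)
    ∘ (id2 (rd_ob dY) ⊠ (rd_cup dX ⊠ id2 Y)) ∘ (id2 (rd_ob dY) ⊠ luV Y) ∘ rd_cup dY;
  rd_cap := rd_cap dX ∘ (id2 X ⊠ lu dX) ∘ (id2 X ⊠ (rd_cap dY ⊠ id2 (rd_ob dX)))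
    ∘ (id2 X ⊠ asV Y dY dX) ∘ as_ X Y (dY ⊗ dX)
|}.

Definition id_rdual (r : C) : rdual_data (id1 r) := {|
  rd_ob := id1 r;
  rd_cup := luV (id1 r);
  rd_cap := lu (id1 r)
|}.

Definition rtranspose (r s : C) (X Y : mor r s) (dX : rdual_data X) (dY : rdual_data Y)
    (f : X ⇒ Y) : rd_ob dY ⇒ rd_ob dX :=
  ru dX ∘ (id2 (rd_ob dX) ⊠ rd_cap dY)
    ∘ (id2 (rd_ob dX) ⊠ (f ⊠ id2 (rd_ob dY))) ∘ as_ dX X dY
    ∘ (rd_cup dX ⊠ id2 (rd_ob dY)) ∘ luV dY.

                                                                         
Definition rdual_compare (r s : C) (X : mor r s) (d d' : rdual_data X) :
    rd_ob d ⇒ rd_ob d' :=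
  rtranspose d' d (id2 X).

End Duals.

                             

Section DoubleDual.
Variables (C : twocat) (rd : forall (r s : C) (X : mor r s), rdual_data X).
Arguments rd {r s} X.

                                                                              
                                                                         
Definition dd_pfun : pfun_data C C := {|
  pf_ob := fun r => r;
  pf_mor := fun r s X => rd (rd X);
  pf_cell := fun r s X Y f => rtranspose (rd (rd Y)) (rd (rd X)) (rtranspose (rd X) (rd Y) f);
  pf_m := fun r s t X Y =>
    rtranspose (rd (rd (X ⊗ Y))) (comp_rdual (rd (rd Y)) (rd (rd X)))
      (rdual_compare (rd (X ⊗ Y)) (comp_rdual (rd X) (rd Y)));
  pf_mV := fun r s t X Y =>
    rtranspose (comp_rdual (rd (rd Y)) (rd (rd X))) (rd (rd (X ⊗ Y)))
      (rdual_compare (comp_rdual (rd X) (rd Y)) (rd (X ⊗ Y)));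
  pf_u := fun r =>
    rtranspose (rd (rd (id1 r))) (id_rdual r) (rdual_compare (rd (id1 r)) (id_rdual r));
  pf_uV := fun r =>
    rtranspose (id_rdual r) (rd (rd (id1 r))) (rdual_compare (id_rdual r) (rd (id1 r)))
|}.

Definition dd_icon (i : forall (r s : C) (X : mor r s), rd_ob (rd (rd X)) ⇒ X) :
    ptrans_data dd_pfun (id_pfun C) :=
  @Build_ptrans_data C C dd_pfun (id_pfun C)
    (fun r => id1 r)
    (fun r s X => luV X ∘ i r s X ∘ ru (rd (rd X))).

End DoubleDual.

Record pivotal := {
  piv_base :> twocat;
  rdual : forall (r s : piv_base) (X : mor r s), rdual_data X;
  rdualP : forall (r s : piv_base) (X : mor r s), is_rdual (rdual X);
  iota : forall (r s : piv_base) (X : mor r s), rd_ob (rdual (rdual X)) ⇒ X;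
  iotaV : forall (r s : piv_base) (X : mor r s), X ⇒ rd_ob (rdual (rdual X));
  iota_inv : forall (r s : piv_base) (X : mor r s), inverse2 (iota X) (iotaV X);
  iota_icon : is_pseudonatural (dd_icon iota)
}.

Arguments rdual {p r s} X.
Arguments iota {p r s} X.
Arguments iotaV {p r s} X.

Definition ldual (C : pivotal) (r s : C) (X : mor r s) : ldual_data X := {|
  ld_ob := rdual X;
  ld_cup := (iota X ⊠ id2 (rd_ob (rdual X))) ∘ rd_cup (rdual (rdual X));
  ld_cap := rd_cap (rdual (rdual X)) ∘ (id2 (rd_ob (rdual X)) ⊠ iotaV X)
|}.

Arguments ldual {C r s} X.

                

Record dagger (C : twocat) := {
  dag : forall (r s : C) (X Y : mor r s), X ⇒ Y -> Y ⇒ X;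
  dagK : forall (r s : C) (X Y : mor r s) (f : X ⇒ Y), dag (dag f) = f;
  dag_id2 : forall (r s : C) (X : mor r s), dag (id2 X) = id2 X;
  dag_vcomp : forall (r s : C) (X Y Z : mor r s) (g : Y ⇒ Z) (f : X ⇒ Y),
    dag (g ∘ f) = dag f ∘ dag g;
  dag_hcomp : forall (r s t : C) (X X' : mor r s) (Y Y' : mor s t)
      (f : X ⇒ X') (g : Y ⇒ Y'),
    dag (f ⊠ g) = dag f ⊠ dag g
}.

Record pivotal_dagger := {
  pd_pivotal :> pivotal;
  pd_dagger : dagger pd_pivotal;
  ldual_cup_dag : forall (r s : pd_pivotal) (X : mor r s),
    ld_cup (ldual X) = dag pd_dagger (rd_cap (rdual X));
  ldual_cap_dag : forall (r s : pd_pivotal) (X : mor r s),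
    ld_cap (ldual X) = dag pd_dagger (rd_cup (rdual X))
}.

Notation "f '^†'" := (dag (pd_dagger _) f) : twocat_scope.

Definition unitary (C : pivotal_dagger) (r s : C) (X Y : mor r s) (f : X ⇒ Y) : Prop :=
  f^† ∘ f = id2 X /\ f ∘ f^† = id2 Y.

Record unitary_pfun (C D : pivotal_dagger) (F : pfun_data C D) : Prop := {
  upf_dag : forall (r s : C) (X Y : mor r s) (f : X ⇒ Y), pf_cell F (f^†) = (pf_cell F f)^†;
  upf_m : forall (r s t : C) (X : mor r s) (Y : mor s t), unitary (pf_m F X Y);
  upf_u : forall r : C, unitary (pf_u F r)
}.

                                                                

                                      
Definition pf_rdual (C D : twocat) (F : pfun_data C D) (r s : C) (X : mor r s)
    (d : ldual_data X) : rdual_data (pf_mor F d) := {|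
  rd_ob := pf_mor F X;
  rd_cup := pf_mV F X d ∘ pf_cell F (ld_cup d) ∘ pf_u F r;
  rd_cap := pf_uV F s ∘ pf_cell F (ld_cap d) ∘ pf_m F d X
|}.

Definition ptrans_dual (C D : pivotal) (F G : pfun_data C D) (a : ptrans_data F G) :
    ptrans_data G F := {|
  pt_mor := fun r => rdual (a r);
  pt_cell := fun r s X =>
    rtranspose (comp_rdual (pf_rdual F (ldual X)) (rdual (a r)))
               (comp_rdual (rdual (a s)) (pf_rdual G (ldual X)))
               (pt_cell a (ldual X))
|}.

Definition ptrans_dagger (C D : pivotal_dagger) (F G : pfun_data C D) (a : ptrans_data F G) :
    ptrans_data G F := {|
  pt_mor := fun r => rdual (a r);
  pt_cell := fun r s X =>
    let ar := rd_ob (rdual (a r)) in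
    let as' := rd_ob (rdual (a s)) in
    let FX := pf_mor F X in
    let GX := pf_mor G X in
    (id2 ar ⊠ ru FX)
    ∘ (id2 ar ⊠ (id2 FX ⊠ rd_cap (rdual (a s))))
    ∘ (id2 ar ⊠ as_ FX (a s) as')
    ∘ (id2 ar ⊠ ((pt_cell a X)^† ⊠ id2 as'))
    ∘ (id2 ar ⊠ asV (a r) GX as')
    ∘ as_ ar (a r) (GX ⊗ as')
    ∘ (rd_cup (rdual (a r)) ⊠ id2 (GX ⊗ as'))
    ∘ luV (GX ⊗ as')
|}.

(* Main.v *)
From Stdlib Require Import Eqdep FunctionalExtensionality.
Require Import Defs.

(** Bending the legs of [f : P ⊗ B ⇒ R ⊗ Q] along right duals of [P] and [Q] gives its mate
    [B ⊗ Q* ⇒ P* ⊗ R], and the snake equations make this operation injective ([mateK]).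
    Both 2-morphisms compared in the theorem are mates along the duals of the components
    of [alpha]:

    - the cell of the dagger at [X] is by construction the mate of [(alpha_X)^†];
    - the cell of the dual at [X] is a transpose along composite duals, and such a transpose
      is an iterated mate ([rtranspose_comp]): first bend [alpha] at [*X] along [F X] and
      [G X], then bend the result [beta_X] along the duals of the components.

    So the dual and the dagger agree exactly when [beta_X] and [(alpha_X)^†] agree for all
    [X].  Now [beta_X] is the inverse of [alpha_X] ([pt_cell_mate]): stacking [alpha_X] on
    [alpha_{*X}] gives [alpha] at [X ⊗ *X]; by naturality it slides across the cup of [*X]
    and becomes [alpha] at an identity, which is trivial, and what remains is a zigzag on
    [G X].  Hence the dual equals the dagger exactly when every [(alpha_X)^†] is the inverse
    of [alpha_X], which is unitarity.

    Associativity and unit laws of 1-morphisms are propositional equalities here, so string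
    diagrams are compared in two ways.  Where bracketings differ, cells are compared by the
    relation [≈], which identifies cells that differ by transport along equalities of
    1-morphisms.  Where cells slide past each other, all 1-morphisms are bracketed to the
    right and a cup, a cap or a square acts on the head of such a word ([cupw], [capw],
    [sqw]); boundaries then match on the nose and ordinary rewriting applies. *)

Set Implicit Arguments.
Unset Strict Implicit.
Unset Printing Implicit Defensive.

(** * Cells up to transport of their boundaries *)

Notation "W ⊲ f" := (id2 W ⊠ f) (at level 42, right associativity) : twocat_scope.
Notation "f ⊳ Z" := (f ⊠ id2 Z) (at level 42, right associativity) : twocat_scope.

(** A cell is related to its transports along equalities of its source and target.  Indexing
    by the boundary lets the associators and unitors be discarded, while [heq_eq] recovers
    plain equality once the boundaries agree. *)
Inductive heq (C : twocat) (r s : C) (X Y : mor r s) (f : X ⇒ Y) :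
    forall X' Y' : mor r s, X' ⇒ Y' -> Prop :=
  heq_refl : heq f f.

Notation "f ≈ g" := (heq f g) (at level 70, no associativity) : twocat_scope.

#[local] Hint Resolve heq_refl : core.

Section HeterogeneousEquality.
Variable C : twocat.

(** Uniqueness of identity proofs in the types of 1-morphisms enters here; it is what makes
    all diagrams of associators and unitors commute. *)
Lemma heq_eq (r s : C) (X Y : mor r s) (f g : X ⇒ Y) : f ≈ g -> f = g.
Proof.
  intros h.
  cut (existT (fun X => {Y : mor r s & X ⇒ Y}) X (existT _ Y f) = existT _ X (existT _ Y g)).
  - intros e. exact (inj_pair2 _ _ _ _ _ (inj_pair2 _ _ _ _ _ e)).
  - destruct h. reflexivity.
Qed.

Lemma heq_sym (r s : C) (X Y X' Y' : mor r s) (f : X ⇒ Y) (g : X' ⇒ Y') : f ≈ g -> g ≈ f.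
Proof. intros h. destruct h. auto. Qed.

Lemma heq_trans (r s : C) (X Y X' Y' X'' Y'' : mor r s)
    (f : X ⇒ Y) (g : X' ⇒ Y') (h : X'' ⇒ Y'') : f ≈ g -> g ≈ h -> f ≈ h.
Proof. intros h1 h2. destruct h1. exact h2. Qed.

Lemma heq_dom (r s : C) (X Y X' Y' : mor r s) (f : X ⇒ Y) (g : X' ⇒ Y') : f ≈ g -> X = X'.
Proof. intros h. now destruct h. Qed.

Lemma heq_cod (r s : C) (X Y X' Y' : mor r s) (f : X ⇒ Y) (g : X' ⇒ Y') : f ≈ g -> Y = Y'.
Proof. intros h. now destruct h. Qed.

Lemma heq_hcomp (r s t : C) (X Y X' Y' : mor r s) (Z W Z' W' : mor s t)
    (f : X ⇒ Y) (f' : X' ⇒ Y') (g : Z ⇒ W) (g' : Z' ⇒ W') :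
  f ≈ f' -> g ≈ g' -> f ⊠ g ≈ f' ⊠ g'.
Proof. intros h1 h2. destruct h1, h2. auto. Qed.

(** The middle 1-morphisms [Y] and [Y'] are identified once by [g ≈ g'] and once by [f ≈ f'];
    by [heq_eq] the two identifications cannot conflict. *)
Lemma heq_vcomp (r s : C) (X Y Z X' Y' Z' : mor r s)
    (f : X ⇒ Y) (f' : X' ⇒ Y') (g : Y ⇒ Z) (g' : Y' ⇒ Z') :
  g ≈ g' -> f ≈ f' -> g ∘ f ≈ g' ∘ f'.
Proof.
  intros h1 h2.
  pose proof (heq_cod h1) as eZ.
  destruct h2, eZ. rewrite (heq_eq h1). auto.
Qed.

Lemma idcell_heq (r s : C) (X Y : mor r s) (e : X = Y) : idcell e ≈ id2 Y.
Proof. destruct e. auto. Qed.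

(** The hypothesis is the form in which associators, unitors and their whiskerings are
    recognised: such cells can be erased from a composite. *)
Lemma heq_idl (r s : C) (X Y Z W : mor r s) (i : Y ⇒ Z) (f : X ⇒ Y) :
  i ≈ id2 W -> i ∘ f ≈ f.
Proof.
  intros h.
  pose proof (heq_dom h) as eY. pose proof (heq_cod h) as eZ.
  subst Y Z. rewrite (heq_eq h), vcomp_idl. auto.
Qed.

Lemma heq_idr (r s : C) (X Y Z W : mor r s) (f : Y ⇒ Z) (i : X ⇒ Y) :
  i ≈ id2 W -> f ∘ i ≈ f.
Proof.
  intros h.
  pose proof (heq_dom h) as eX. pose proof (heq_cod h) as eY.
  subst X Y. rewrite (heq_eq h), vcomp_idr. auto.
Qed.

Lemma hcompA_heq (r s t u : C) (X X' : mor r s) (Y Y' : mor s t) (Z Z' : mor t u)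
    (f : X ⇒ X') (g : Y ⇒ Y') (h : Z ⇒ Z') : (f ⊠ g) ⊠ h ≈ f ⊠ (g ⊠ h).
Proof.
  apply heq_trans with (2 := heq_idr _ (idcell_heq (comp1A X Y Z))).
  rewrite <- hcompA. apply heq_sym, (heq_idl _ (idcell_heq _)).
Qed.

Lemma hcomp_idl_heq (r s : C) (X Y : mor r s) (f : X ⇒ Y) : id1 r ⊲ f ≈ f.
Proof.
  apply heq_trans with (2 := heq_idr _ (idcell_heq (comp1_idl X))).
  rewrite <- hcomp_idl. apply heq_sym, (heq_idl _ (idcell_heq _)).
Qed.

Lemma hcomp_idr_heq (r s : C) (X Y : mor r s) (f : X ⇒ Y) : f ⊳ id1 s ≈ f.
Proof.
  apply heq_trans with (2 := heq_idr _ (idcell_heq (comp1_idr X))).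
  rewrite <- hcomp_idr. apply heq_sym, (heq_idl _ (idcell_heq _)).
Qed.

Lemma as_heq (r s t u : C) (X : mor r s) (Y : mor s t) (Z : mor t u) :
  as_ X Y Z ≈ id2 (X ⊗ (Y ⊗ Z)).
Proof. apply idcell_heq. Qed.

Lemma asV_heq (r s t u : C) (X : mor r s) (Y : mor s t) (Z : mor t u) :
  asV X Y Z ≈ id2 ((X ⊗ Y) ⊗ Z).
Proof. apply idcell_heq. Qed.

Lemma lu_heq (r s : C) (X : mor r s) : lu X ≈ id2 X.
Proof. apply idcell_heq. Qed.

Lemma luV_heq (r s : C) (X : mor r s) : luV X ≈ id2 (id1 r ⊗ X).
Proof. apply idcell_heq. Qed.

Lemma ru_heq (r s : C) (X : mor r s) : ru X ≈ id2 X.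
Proof. apply idcell_heq. Qed.

Lemma ruV_heq (r s : C) (X : mor r s) : ruV X ≈ id2 (X ⊗ id1 s).
Proof. apply idcell_heq. Qed.

Lemma id_hcomp_heq (r s t : C) (X Y V : mor r s) (Z W U : mor s t) (i : X ⇒ Y) (j : Z ⇒ W) :
  i ≈ id2 V -> j ≈ id2 U -> i ⊠ j ≈ id2 (V ⊗ U).
Proof. intros h1 h2. rewrite <- hcomp_id2. apply heq_hcomp; assumption. Qed.

Lemma whl_vcomp (r s t : C) (W : mor r s) (X Y Z : mor s t) (g : Y ⇒ Z) (f : X ⇒ Y) :
  W ⊲ (g ∘ f) = (W ⊲ g) ∘ (W ⊲ f).
Proof. now rewrite <- interchange, vcomp_idl. Qed.

Lemma whr_vcomp (r s t : C) (W : mor s t) (X Y Z : mor r s) (g : Y ⇒ Z) (f : X ⇒ Y) :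
  (g ∘ f) ⊳ W = (g ⊳ W) ∘ (f ⊳ W).
Proof. now rewrite <- interchange, vcomp_idl. Qed.

Lemma exchange (r s t : C) (X Y : mor r s) (Z W : mor s t) (f : X ⇒ Y) (g : Z ⇒ W) :
  (Y ⊲ g) ∘ (f ⊳ Z) = (f ⊳ W) ∘ (X ⊲ g).
Proof. now rewrite <- !interchange, !vcomp_idl, !vcomp_idr. Qed.

End HeterogeneousEquality.

(** [drop_identities] erases associators, unitors and their whiskerings at both ends of the
    compared composites.  Inner factors are left alone: without them the remaining factors
    would not be composable. *)
Create HintDb coh.
#[local] Hint Resolve as_heq asV_heq lu_heq luV_heq ru_heq ruV_heq id_hcomp_heq heq_refl : coh.

Ltac drop_identities :=
  repeat first
    [ match goal with |- heq (vcomp _ _) _ =>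
        eapply heq_trans; [eapply heq_idl; solve [eauto with coh] |] end
    | match goal with |- heq (vcomp _ _) _ =>
        eapply heq_trans; [eapply heq_idr; solve [eauto with coh] |] end
    | match goal with |- heq _ (vcomp _ _) =>
        eapply heq_trans; [|apply heq_sym; eapply heq_idl; solve [eauto with coh] ] end
    | match goal with |- heq _ (vcomp _ _) =>
        eapply heq_trans; [|apply heq_sym; eapply heq_idr; solve [eauto with coh] ] end ].

Ltac coherence := apply heq_eq; drop_identities.

Section Cancellation.
Variable C : twocat.

Lemma idcellV (r s : C) (X Y : mor r s) (e : X = Y) : idcell (eq_sym e) ∘ idcell e = id2 X.
Proof. destruct e. apply vcomp_idl. Qed.

Lemma idcellK (r s : C) (X Y : mor r s) (e : X = Y) : idcell e ∘ idcell (eq_sym e) = id2 Y.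
Proof. destruct e. apply vcomp_idl. Qed.

Lemma ru_nat (r s : C) (X Y : mor r s) (f : X ⇒ Y) : ru Y ∘ (f ⊳ id1 s) = f ∘ ru X.
Proof. apply hcomp_idr. Qed.

Lemma luV_nat (r s : C) (X Y : mor r s) (f : X ⇒ Y) : luV Y ∘ f = (id1 r ⊲ f) ∘ luV X.
Proof. coherence. apply heq_sym, hcomp_idl_heq. Qed.

Lemma lu_luV (r s : C) (X : mor r s) : lu X ∘ luV X = id2 X.
Proof. apply idcellK. Qed.

Lemma lu_nat (r s : C) (X Y : mor r s) (f : X ⇒ Y) : lu Y ∘ (id1 r ⊲ f) = f ∘ lu X.
Proof. apply hcomp_idl. Qed.

Lemma as_nat (r s t u : C) (X X' : mor r s) (Y Y' : mor s t) (Z Z' : mor t u)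
    (f : X ⇒ X') (g : Y ⇒ Y') (h : Z ⇒ Z') :
    as_ X' Y' Z' ∘ ((f ⊠ g) ⊠ h) = (f ⊠ (g ⊠ h)) ∘ as_ X Y Z.
Proof. apply hcompA. Qed.

Lemma asV_nat (r s t u : C) (X X' : mor r s) (Y Y' : mor s t) (Z Z' : mor t u)
    (f : X ⇒ X') (g : Y ⇒ Y') (h : Z ⇒ Z') :
    asV X' Y' Z' ∘ (f ⊠ (g ⊠ h)) = ((f ⊠ g) ⊠ h) ∘ asV X Y Z.
Proof. coherence. apply heq_sym, hcompA_heq. Qed.

End Cancellation.

(** * Squares, cups and caps on right-bracketed words *)

Section Whiskered.
Variable C : twocat.

(** Conjugation by associators keeps source and target bracketed to the right, so that squares,
    cups and caps can be stacked with nothing in between. *)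
Definition sqw (r s t s' u : C) (A : mor r s) (B : mor s t) (A' : mor r s') (B' : mor s' t)
    (f : A ⊗ B ⇒ A' ⊗ B') (Z : mor t u) : A ⊗ (B ⊗ Z) ⇒ A' ⊗ (B' ⊗ Z) :=
  as_ A' B' Z ∘ (f ⊳ Z) ∘ asV A B Z.

Definition cupw (r s u : C) (X : mor r s) (d : rdual_data X) (Z : mor s u) : Z ⇒ d ⊗ (X ⊗ Z) :=
  as_ d X Z ∘ (rd_cup d ⊳ Z) ∘ luV Z.

Definition capw (r s u : C) (X : mor r s) (d : rdual_data X) (Z : mor r u) : X ⊗ (d ⊗ Z) ⇒ Z :=
  lu Z ∘ (rd_cap d ⊳ Z) ∘ asV X d Z.

Lemma sqw_heq (r s t s' u : C) (A : mor r s) (B : mor s t) (A' : mor r s') (B' : mor s' t)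
    (f : A ⊗ B ⇒ A' ⊗ B') (Z : mor t u) : sqw f Z ≈ f ⊳ Z.
Proof.
  unfold sqw. eapply heq_trans; [apply (heq_idr _ (asV_heq _ _ _))|].
  apply (heq_idl _ (as_heq _ _ _)).
Qed.

Lemma cupw_heq (r s u : C) (X : mor r s) (d : rdual_data X) (Z : mor s u) :
  cupw d Z ≈ rd_cup d ⊳ Z.
Proof.
  eapply heq_trans; [apply (heq_idr _ (luV_heq _))|].
  apply (heq_idl _ (as_heq _ _ _)).
Qed.

Lemma capw_heq (r s u : C) (X : mor r s) (d : rdual_data X) (Z : mor r u) :
  capw d Z ≈ rd_cap d ⊳ Z.
Proof.
  eapply heq_trans; [apply (heq_idr _ (asV_heq _ _ _))|].
  apply (heq_idl _ (lu_heq _)).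
Qed.

Lemma whr_whr (r s t u : C) (X Y : mor r s) (f : X ⇒ Y) (Z : mor s t) (W : mor t u) :
  (f ⊳ Z) ⊳ W ≈ f ⊳ (Z ⊗ W).
Proof. rewrite <- hcomp_id2. apply hcompA_heq. Qed.

Lemma sqw_whr (r s t s' u v : C) (A : mor r s) (B : mor s t) (A' : mor r s') (B' : mor s' t)
    (f : A ⊗ B ⇒ A' ⊗ B') (Z : mor t u) (W : mor u v) : sqw f Z ⊳ W ≈ sqw f (Z ⊗ W).
Proof.
  apply heq_trans with (2 := heq_sym (sqw_heq f (Z ⊗ W))).
  apply heq_trans with (2 := whr_whr _ _ _).
  apply heq_hcomp; auto using sqw_heq.
Qed.

Lemma cupw_whr (r s u v : C) (X : mor r s) (d : rdual_data X) (Z : mor s u) (W : mor u v) :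
  cupw d Z ⊳ W ≈ cupw d (Z ⊗ W).
Proof.
  apply heq_trans with (2 := heq_sym (cupw_heq d (Z ⊗ W))).
  apply heq_trans with (2 := whr_whr _ _ _).
  apply heq_hcomp; auto using cupw_heq.
Qed.

Lemma capw_whr (r s u v : C) (X : mor r s) (d : rdual_data X) (Z : mor r u) (W : mor u v) :
  capw d Z ⊳ W ≈ capw d (Z ⊗ W).
Proof.
  apply heq_trans with (2 := heq_sym (capw_heq d (Z ⊗ W))).
  apply heq_trans with (2 := whr_whr _ _ _).
  apply heq_hcomp; auto using capw_heq.
Qed.

Lemma sqw_unit (r s t s' : C) (A : mor r s) (B : mor s t) (A' : mor r s') (B' : mor s' t)
    (f : A ⊗ B ⇒ A' ⊗ B') : (A' ⊲ ru B') ∘ sqw f (id1 t) = f ∘ (A ⊲ ru B).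
Proof.
  coherence. eapply heq_trans; [apply sqw_heq | apply hcomp_idr_heq].
Qed.

Lemma sqw_nat (r s t s' u : C) (A : mor r s) (B : mor s t) (A' : mor r s') (B' : mor s' t)
    (f : A ⊗ B ⇒ A' ⊗ B') (Z W : mor t u) (g : Z ⇒ W) :
  sqw f W ∘ (A ⊲ (B ⊲ g)) = (A' ⊲ (B' ⊲ g)) ∘ sqw f Z.
Proof.
  unfold sqw. rewrite <- !vcompA, asV_nat, hcomp_id2, !vcompA. f_equal.
  rewrite <- hcompA, <- !vcompA. f_equal. rewrite hcomp_id2. symmetry. apply exchange.
Qed.

Lemma capw_nat (r s u : C) (X : mor r s) (d : rdual_data X) (Z W : mor r u) (g : Z ⇒ W) :
  capw d W ∘ (X ⊲ (d ⊲ g)) = g ∘ capw d Z.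
Proof.
  unfold capw. rewrite <- !vcompA, asV_nat, hcomp_id2, !vcompA. f_equal.
  rewrite <- lu_nat, <- !vcompA. f_equal. symmetry. apply exchange.
Qed.

(** The snake equation along [X], whiskered by [Z]; the relation [≈] absorbs the rebracketing. *)
Lemma capw_cupw (r s u : C) (X : mor r s) (d : rdual_data X) (Z : mor s u) :
  is_rdual d -> capw d (X ⊗ Z) ∘ (X ⊲ cupw d Z) = id2 (X ⊗ Z).
Proof.
  intros hd. rewrite <- hcomp_id2.
  pose proof (rd_snake hd) as h.
  change ((capw d X ∘ (X ⊲ rd_cup d)) ∘ ruV X = id2 X) in h.
  rewrite <- vcompA in h.
  transitivity ((capw d X ∘ ((X ⊲ rd_cup d) ∘ ruV X)) ⊳ Z); [|now rewrite h].
  rewrite whr_vcomp.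
  apply heq_eq, heq_vcomp.
  - apply heq_sym, capw_whr.
  - rewrite whr_vcomp. drop_identities.
    apply heq_trans with (2 := heq_sym (hcompA_heq _ _ _)).
    apply heq_hcomp; auto using cupw_heq.
Qed.

(** The leg [P] of [f] is bent down on the left by the cup of [P], the leg [Q] is bent up on
    the right by the cap of [Q]. *)
Definition mate (p q r s : C) (P : mor p q) (B : mor q s) (R : mor p r) (Q : mor r s)
    (dP : rdual_data P) (dQ : rdual_data Q) (f : P ⊗ B ⇒ R ⊗ Q) : B ⊗ dQ ⇒ dP ⊗ R :=
  (dP ⊲ (ru R ∘ (R ⊲ rd_cap dQ) ∘ sqw f dQ)) ∘ cupw dP (B ⊗ dQ).

Lemma sqw_mate (p q r s t : C) (P : mor p q) (B : mor q s) (R : mor p r) (Q : mor r s)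
    (dP : rdual_data P) (dQ : rdual_data Q) (f : P ⊗ B ⇒ R ⊗ Q) (Z : mor r t) :
  sqw (mate dP dQ f) Z = (dP ⊲ ((R ⊲ capw dQ Z) ∘ sqw f (dQ ⊗ Z))) ∘ cupw dP (B ⊗ (dQ ⊗ Z)).
Proof.
  apply heq_eq. eapply heq_trans; [apply sqw_heq|]. unfold mate. rewrite whr_vcomp.
  apply heq_vcomp.
  - eapply heq_trans; [apply hcompA_heq|]. apply heq_hcomp; auto.
    rewrite <- vcompA, whr_vcomp. drop_identities. rewrite whr_vcomp. apply heq_vcomp.
    + eapply heq_trans; [apply hcompA_heq|].
      apply heq_hcomp; auto using heq_sym, capw_heq.
    + apply sqw_whr.
  - eapply heq_trans; [apply cupw_whr|]. rewrite (comp1A B dQ Z). auto.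
Qed.

(** The opposite bending: the cap of [P] and the cup of [Q] put both legs back. *)
Definition unmate (p q r s : C) (P : mor p q) (B : mor q s) (R : mor p r) (Q : mor r s)
    (dP : rdual_data P) (dQ : rdual_data Q) (g : B ⊗ dQ ⇒ dP ⊗ R) : P ⊗ B ⇒ R ⊗ Q :=
  capw dP (R ⊗ Q) ∘ (P ⊲ (sqw g Q ∘ (B ⊲ rd_cup dQ) ∘ ruV B)).

(** Each leg of [f] bent twice is a zigzag; sliding [f] past the cap of [P] and the cup of [Q]
    isolates the two zigzags, which are straightened by the snake equations. *)
Lemma mateK (p q r s : C) (P : mor p q) (B : mor q s) (R : mor p r) (Q : mor r s)
    (dP : rdual_data P) (dQ : rdual_data Q) (f : P ⊗ B ⇒ R ⊗ Q) :
  is_rdual dP -> is_rdual dQ -> unmate (mate dP dQ f) = f.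
Proof.
  intros hP hQ. unfold unmate. rewrite sqw_mate, !whl_vcomp, !vcompA.
  (* apply the cap of P before the rest of the diagram, directly after the cup of P *)
  rewrite capw_nat.
  rewrite <- (vcompA _ (capw _ _)), capw_nat, vcompA.
  rewrite <- (vcompA _ (capw _ _)), capw_cupw, vcomp_idr by assumption.
  (* apply f before the cup of Q, so that the cap of Q directly follows this cup *)
  rewrite <- (vcompA _ (sqw f _)), sqw_nat, vcompA.
  rewrite <- (vcompA _ (sqw f _)).
  assert (e : sqw f (id1 s) ∘ (P ⊲ ruV B) = (R ⊲ ruV Q) ∘ f).
  { coherence. eapply heq_trans; [apply sqw_heq | apply hcomp_idr_heq]. }
  rewrite e, vcompA, <- !whl_vcomp.
  pose proof (rd_snake hQ) as h.
  change (capw dQ Q ∘ (Q ⊲ rd_cup dQ) ∘ ruV Q = id2 Q) in h.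
  rewrite h, hcomp_id2. apply vcomp_idl.
Qed.

End Whiskered.

(** * Transposes and zigzags *)

Section RightDuals.
Variable C : twocat.

Lemma comp_rdual_cupw (r s t u : C) (X : mor r s) (Y : mor s t)
    (dX : rdual_data X) (dY : rdual_data Y) (Z : mor t u) :
  cupw (comp_rdual dX dY) Z ≈ (dY ⊲ cupw dX (Y ⊗ Z)) ∘ cupw dY Z.
Proof.
  eapply heq_trans; [apply cupw_heq|]. simpl.
  rewrite <- (vcompA _ _ (rd_cup dY)), <- !vcompA.
  rewrite whr_vcomp. drop_identities. rewrite !vcompA, <- !whl_vcomp, whr_vcomp.
  apply heq_vcomp.
  - eapply heq_trans; [apply hcompA_heq|]. apply heq_hcomp; auto. apply cupw_whr.
  - apply heq_sym, cupw_heq.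
Qed.

(** The cup and the cap of a composite dual are nested, so transposing bends the inner legs
    [P] and [Q] first and the outer legs [B] and [R] afterwards. *)
Lemma rtranspose_comp (p q r s : C) (P : mor p q) (B : mor q s) (R : mor p r) (Q : mor r s)
    (dP : rdual_data P) (dB : rdual_data B) (dR : rdual_data R) (dQ : rdual_data Q)
    (f : P ⊗ B ⇒ R ⊗ Q) :
  rtranspose (comp_rdual dP dB) (comp_rdual dR dQ) f = mate dB dR (mate dP dQ f).
Proof.
  assert (e : rd_cap (comp_rdual dR dQ) ∘ (f ⊳ rd_ob (comp_rdual dR dQ)) ∘ asV P B (dQ ⊗ dR)
    = rd_cap dR ∘ ((R ⊲ capw dQ dR) ∘ sqw f (dQ ⊗ dR))).
  { simpl. unfold capw, sqw. now rewrite !whl_vcomp, !vcompA. }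
  transitivity (ru (dB ⊗ dP) ∘ ((dB ⊗ dP) ⊲ (rd_cap (comp_rdual dR dQ)
      ∘ (f ⊳ rd_ob (comp_rdual dR dQ)))) ∘ cupw (comp_rdual dP dB) (dQ ⊗ dR)).
  { unfold rtranspose, cupw. now rewrite whl_vcomp, !vcompA. }
  transitivity ((dB ⊲ (ru dP ∘ (dP ⊲ (rd_cap dR ∘ ((R ⊲ capw dQ dR) ∘ sqw f (dQ ⊗ dR))))))
      ∘ ((dB ⊲ cupw dP (B ⊗ (dQ ⊗ dR))) ∘ cupw dB (dQ ⊗ dR))).
  - apply heq_eq, heq_vcomp; [|apply comp_rdual_cupw].
    drop_identities. rewrite (whl_vcomp dB). drop_identities.
    rewrite <- e, <- hcomp_id2.
    eapply heq_trans; [apply hcompA_heq|].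
    apply heq_hcomp; auto. apply heq_hcomp; auto.
    apply heq_sym, (heq_idr _ (asV_heq _ _ _)).
  - unfold mate at 1. now rewrite sqw_mate, !whl_vcomp, !vcompA.
Qed.

(** The snake equation whose zigzag runs along the dual [d], not along [X].  It is a
    property of its own because it is transported twice: along [iota] and along
    pseudofunctors. *)
Definition dual_snake (r s : C) (X : mor r s) (d : rdual_data X) : Prop :=
  ru d ∘ (d ⊲ rd_cap d) ∘ cupw d d = id2 (rd_ob d).

Lemma is_rdual_dual_snake (r s : C) (X : mor r s) (d : rdual_data X) :
  is_rdual d -> dual_snake d.
Proof.
  intros h. unfold dual_snake, cupw. rewrite !vcompA. apply rd_snake_dual, h.
Qed.

Lemma cupw_nat (r s u : C) (X : mor r s) (d : rdual_data X) (Z W : mor s u) (g : Z ⇒ W) :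
  cupw d W ∘ g = (d ⊲ (X ⊲ g)) ∘ cupw d Z.
Proof.
  unfold cupw. rewrite <- !vcompA, luV_nat, !vcompA. f_equal.
  rewrite <- as_nat, <- !vcompA, hcomp_id2. f_equal. symmetry. apply exchange.
Qed.

(** The isomorphism and its inverse slide along the zigzag until they meet.  Applied to
    [iota], this turns the right dual of a right dual into a left dual. *)
Lemma dual_snake_iso (r s : C) (X : mor r s) (d : rdual_data X) (Y : mor s r)
    (i : rd_ob d ⇒ Y) (j : Y ⇒ rd_ob d) :
  i ∘ j = id2 Y -> dual_snake d ->
  dual_snake {| rd_ob := Y; rd_cup := (i ⊳ X) ∘ rd_cup d; rd_cap := rd_cap d ∘ (X ⊲ j) |}.
Proof.
  unfold dual_snake. intros hij h.
  set (e := Build_rdual_data _ _).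
  assert (hcup : cupw e Y = (i ⊳ (X ⊗ Y)) ∘ cupw d Y).
  { unfold cupw. simpl. now rewrite whr_vcomp, !vcompA, as_nat, hcomp_id2. }
  change (ru Y ∘ (Y ⊲ (rd_cap d ∘ (X ⊲ j))) ∘ cupw e Y = id2 Y).
  rewrite hcup, whl_vcomp.
  rewrite !vcompA, <- (vcompA _ _ (i ⊳ _)), exchange, !vcompA.
  rewrite <- (vcompA _ _ (i ⊳ _)), exchange, !vcompA, ru_nat.
  rewrite <- (vcompA _ _ (cupw d Y)), <- cupw_nat, vcompA, <- 2!(vcompA i).
  now rewrite h, vcomp_idr.
Qed.

(** A left dual of [X] is an object that has [X] as its right dual. *)
Definition ldual_rdual (r s : C) (X : mor r s) (d : ldual_data X) : rdual_data (ld_ob d) :=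
  {| rd_ob := X; rd_cup := ld_cup d; rd_cap := ld_cap d |}.

End RightDuals.

Lemma ldual_dual_snake (C : pivotal) (r s : C) (X : mor r s) :
  dual_snake (ldual_rdual (ldual X)).
Proof.
  apply dual_snake_iso.
  - apply iota_inv.
  - apply is_rdual_dual_snake, rdualP.
Qed.

(** * Pseudofunctors preserve the zigzag *)

Section PseudofunctorDuals.
Variables (C D : twocat) (F : pseudofunctor C D).

Let HF := pseudofunctorP F.

Lemma pf_mV_nat (r s t : C) (X X' : mor r s) (Y Y' : mor s t) (f : X ⇒ X') (g : Y ⇒ Y') :
  pf_mV F X' Y' ∘ pf_cell F (f ⊠ g) = (pf_cell F f ⊠ pf_cell F g) ∘ pf_mV F X Y.
Proof.
  destruct (pf_m_inv HF X Y) as [_ h]. destruct (pf_m_inv HF X' Y') as [h' _].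
  rewrite <- (vcomp_idr (pf_mV F X' Y' ∘ _)), <- h, vcompA, <- (vcompA _ _ (pf_m F X Y)).
  now rewrite <- (pf_m_nat HF), vcompA, h', vcomp_idl.
Qed.

Lemma pf_cell_luV (r s : C) (X : mor r s) :
  pf_cell F (luV X) = pf_m F (id1 r) X ∘ (pf_u F r ⊳ pf_mor F X) ∘ luV (pf_mor F X).
Proof.
  assert (e : pf_cell F (luV X) ∘ pf_cell F (lu X) = id2 _).
  { unfold luV, lu. now rewrite <- (pf_vcomp HF), idcellV, (pf_id2 HF). }
  transitivity (pf_cell F (luV X) ∘ (lu (pf_mor F X) ∘ luV (pf_mor F X))).
  - now rewrite lu_luV, vcomp_idr.
  - now rewrite <- (pf_unitl HF), !vcompA, e, vcomp_idl.
Qed.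

Lemma pf_cell_as (r s t v : C) (X : mor r s) (Y : mor s t) (Z : mor t v) :
  pf_cell F (as_ X Y Z) ∘ pf_m F (X ⊗ Y) Z
  = pf_m F X (Y ⊗ Z) ∘ (pf_mor F X ⊲ pf_m F Y Z)
    ∘ as_ (pf_mor F X) (pf_mor F Y) (pf_mor F Z) ∘ (pf_mV F X Y ⊳ pf_mor F Z).
Proof.
  destruct (pf_m_inv HF X Y) as [_ h].
  now rewrite <- (pf_assoc HF), <- vcompA, <- whr_vcomp, h, hcomp_id2, vcomp_idr.
Qed.

(** In the zigzag of [pf_rdual F d] the cup is followed by a cap that starts with [pf_m F d X].
    Naturality, associativity and unitality of the multiplicators turn these two factors into
    the image under [F] of a cup. *)
Lemma pf_cupw (r s : C) (X : mor r s) (d : ldual_data X) :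
  (pf_mor F X ⊲ pf_m F d X) ∘ cupw (pf_rdual F d) (pf_mor F X)
  = pf_mV F X (d ⊗ X) ∘ pf_cell F (cupw (ldual_rdual d) X).
Proof.
  destruct (pf_m_inv HF X (d ⊗ X)) as [h _].
  unfold cupw. rewrite !(pf_vcomp HF), pf_cell_luV. simpl.
  rewrite !vcompA, <- (vcompA _ _ (pf_m F (id1 r) X)), <- (pf_m_nat HF), (pf_id2 HF), !vcompA.
  rewrite <- (vcompA _ _ (pf_m F (X ⊗ d) X)), pf_cell_as, !vcompA, h, vcomp_idl.
  now rewrite !whr_vcomp, !vcompA.
Qed.

(** The zigzag of the image is the image of the zigzag: after [pf_cupw] a single
    inverse multiplicator remains, which naturality moves past the cap and unitality then
    cancels against the unitor of the cap. *)
Lemma pf_dual_snake (r s : C) (X : mor r s) (d : ldual_data X) :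
  dual_snake (ldual_rdual d) -> dual_snake (pf_rdual F d).
Proof.
  unfold dual_snake. intros h.
  change (ru X ∘ (X ⊲ ld_cap d) ∘ cupw (ldual_rdual d) X = id2 X) in h.
  change (ru (pf_mor F X) ∘ (pf_mor F X ⊲ rd_cap (pf_rdual F d)) ∘ cupw (pf_rdual F d) (pf_mor F X)
    = id2 (pf_mor F X)).
  simpl. rewrite 2!whl_vcomp, <- !vcompA, pf_cupw.
  transitivity (pf_cell F (ru X ∘ (X ⊲ ld_cap d) ∘ cupw (ldual_rdual d) X));
    [|now rewrite h, (pf_id2 HF)].
  rewrite 2!(pf_vcomp HF), !vcompA. f_equal.
  rewrite <- (vcompA _ _ (pf_mV _ _ _)), <- (pf_id2 HF X), <- pf_mV_nat, vcompA. f_equal.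
  destruct (pf_m_inv HF X (id1 s)) as [_ hm].
  destruct (pf_u_inv HF s) as [_ hu].
  rewrite (pf_id2 HF), <- (pf_unitr HF), <- (vcompA _ _ (_ ⊲ pf_uV F s)), <- whl_vcomp.
  now rewrite hu, hcomp_id2, vcomp_idr, <- vcompA, hm, vcomp_idr.
Qed.

End PseudofunctorDuals.

(** * The inverse of a component as a mate *)

Section Transformation.
Variables (C D : pivotal) (F G : pseudofunctor C D) (a : pseudonatural F G).

Let HF := pseudofunctorP F.
Let HG := pseudofunctorP G.
Let Ha := pseudonaturalP a.

(** The two stacked squares form [a] at [X ⊗ d] by multiplicativity; naturality moves this
    past the image of the cup of [d], leaving [a] at an identity, where it is trivial. *)
Lemma pt_cell_cup (r s : C) (X : mor r s) (d : ldual_data X) :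
  sqw (pt_cell a X) (pf_mor G d) ∘ (pf_mor F X ⊲ pt_cell a d) ∘ cupw (pf_rdual F d) (a r)
  = (a r ⊲ rd_cup (pf_rdual G d)) ∘ ruV (a r).
Proof.
  destruct (pf_m_inv HF X d) as [_ hF]. destruct (pf_m_inv HG X d) as [hG _].
  assert (h : pt_cell a (X ⊗ d) ∘ (pf_m F X d ⊳ a r) = (a r ⊲ pf_m G X d)
      ∘ (sqw (pt_cell a X) (pf_mor G d) ∘ (pf_mor F X ⊲ pt_cell a d) ∘ as_ _ _ _)).
  { unfold sqw. now rewrite (pt_mult Ha), !vcompA. }
  assert (h' : sqw (pt_cell a X) (pf_mor G d) ∘ (pf_mor F X ⊲ pt_cell a d) ∘ as_ _ _ _ =
     (a r ⊲ pf_mV G X d) ∘ (pt_cell a (X ⊗ d) ∘ (pf_m F X d ⊳ a r))).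
  { now rewrite h, !vcompA, <- whl_vcomp, hG, hcomp_id2, vcomp_idl. }
  unfold cupw. simpl. rewrite !vcompA, h'.
  rewrite !whr_vcomp, !whl_vcomp.
  rewrite !vcompA, <- (vcompA _ (pf_m F X d ⊳ _)), <- whr_vcomp, hF, hcomp_id2, vcomp_idr.
  rewrite <- (vcompA _ (pt_cell a (X ⊗ d))), <- (pt_nat Ha), !vcompA.
  rewrite <- (vcompA _ (pt_cell a (id1 r))), (pt_unit Ha), !vcompA.
  rewrite <- (vcompA _ (lu _)), lu_luV. apply vcomp_idr.
Qed.

Lemma pt_cell_cupw (r s : C) (X : mor r s) (d : ldual_data X) (t : D) (Z : mor (G r) t) :
  sqw (pt_cell a X) (pf_mor G d ⊗ Z) ∘ (pf_mor F X ⊲ sqw (pt_cell a d) Z)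
    ∘ cupw (pf_rdual F d) (a r ⊗ Z)
  = a r ⊲ cupw (pf_rdual G d) Z.
Proof.
  apply heq_eq.
  apply heq_trans with (g := ((a r ⊲ rd_cup (pf_rdual G d)) ∘ ruV (a r)) ⊳ Z).
  - rewrite <- pt_cell_cup, !whr_vcomp. repeat apply heq_vcomp.
    + apply heq_sym, sqw_whr.
    + apply heq_trans with (2 := heq_sym (hcompA_heq _ _ _)).
      apply heq_hcomp; auto using sqw_heq.
    + apply heq_sym, (cupw_whr (pf_rdual F d)).
  - rewrite whr_vcomp. drop_identities. eapply heq_trans; [apply hcompA_heq|].
    apply heq_hcomp; auto. apply heq_sym, (cupw_heq (pf_rdual G d)).
Qed.

(** Once the component at [X] is moved inside the diagram of the mate it absorbs the cup of
    [F] by [pt_cell_cupw], and a zigzag on [pf_mor G X] is left. *)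
Lemma pt_cell_mate (r s : C) (X : mor r s) (d : ldual_data X) :
  dual_snake (ldual_rdual d) ->
  pt_cell a X ∘ mate (pf_rdual F d) (pf_rdual G d) (pt_cell a d) = id2 (a r ⊗ pf_mor G X).
Proof.
  intros h. apply (@pf_dual_snake _ _ G) in h.
  unfold mate. simpl rd_ob.
  rewrite !whl_vcomp, !vcompA, <- sqw_unit.
  rewrite <- (vcompA _ (sqw (pt_cell a X) _)), sqw_nat, vcompA.
  transitivity ((a r ⊲ ru (pf_mor G X)) ∘ (a r ⊲ (pf_mor G X ⊲ rd_cap (pf_rdual G d)))
    ∘ (a r ⊲ cupw (pf_rdual G d) (pf_mor G X))).
  - rewrite <- pt_cell_cupw, !vcompA. reflexivity.
  - rewrite <- !whl_vcomp, <- hcomp_id2. f_equal. exact h.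
Qed.

End Transformation.

(** * Dual and dagger as mates *)

(** The cells depend on the 1-morphism components [m]; keeping these fixed makes the equality
    of the cells an equality inside one type. *)
Lemma ptrans_data_inj (C D : twocat) (F G : pfun_data C D) (m : forall r : C, mor (F r) (G r))
    (c c' : forall (r s : C) (X : mor r s), pf_mor F X ⊗ m s ⇒ m r ⊗ pf_mor G X) :
  Build_ptrans_data c = Build_ptrans_data c' -> c = c'.
Proof.
  intros e.
  apply (f_equal (fun p : ptrans_data F G => existT
    (fun m : forall r : C, mor (F r) (G r) =>
       forall (r s : C) (X : mor r s), pf_mor F X ⊗ m s ⇒ m r ⊗ pf_mor G X)
    (pt_mor p) (@pt_cell C D F G p))) in e.
  exact (inj_pair2 _ _ _ _ _ e).
Qed.

Lemma ptrans_dagger_mate (C D : pivotal_dagger) (F G : pfun_data C D) (a : ptrans_data F G)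
    (r s : C) (X : mor r s) :
  pt_cell (ptrans_dagger a) X
  = mate (rdual (a r)) (rdual (a s)) (dag (pd_dagger D) (pt_cell a X)).
Proof.
  unfold mate, cupw, sqw. rewrite !whl_vcomp, !vcompA. reflexivity.
Qed.

Lemma ptrans_dual_mate (C D : pivotal) (F G : pfun_data C D) (a : ptrans_data F G)
    (r s : C) (X : mor r s) :
  pt_cell (ptrans_dual a) X
  = mate (rdual (a r)) (rdual (a s))
      (mate (pf_rdual F (ldual X)) (pf_rdual G (ldual X)) (pt_cell a (ldual X))).
Proof.
  exact (rtranspose_comp (pf_rdual F (ldual X)) (rdual (a r)) (rdual (a s))
    (pf_rdual G (ldual X)) (pt_cell a (ldual X))).
Qed.

Lemma inverse2_unique (C : twocat) (r s : C) (X Y : mor r s) (f : X ⇒ Y) (g h : Y ⇒ X) :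
  inverse2 f g -> f ∘ h = id2 Y -> h = g.
Proof.
  intros [hg _] hh. now rewrite <- (vcomp_idl h), <- hg, <- vcompA, hh, vcomp_idr.
Qed.

Theorem lemma4p2 (C D : pivotal_dagger) (F G : pseudofunctor C D)
  (hF : unitary_pfun F) (hG : unitary_pfun G) (alpha : pseudonatural F G) :
  ptrans_dual alpha = ptrans_dagger alpha <->
  (forall (r s : C) (X : mor r s), unitary (pt_cell alpha X)).
Proof.
  set (beta := fun (r s : C) (X : mor r s) =>
    mate (pf_rdual F (ldual X)) (pf_rdual G (ldual X)) (pt_cell alpha (ldual X))).
  assert (hbeta : forall (r s : C) (X : mor r s),
    pt_cell alpha X ∘ beta r s X = id2 (alpha r ⊗ pf_mor G X)).
  { intros r s X. apply pt_cell_mate, ldual_dual_snake. }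
  split.
  - intros e r s X.
    assert (eb : dag (pd_dagger D) (pt_cell alpha X) = beta r s X).
    { (* both sides have the same mate *)
      rewrite <- (mateK (beta r s X) (rdualP (alpha r)) (rdualP (alpha s))).
      rewrite <- (mateK (dag _ _) (rdualP (alpha r)) (rdualP (alpha s))).
      f_equal. rewrite <- ptrans_dagger_mate. unfold beta. rewrite <- ptrans_dual_mate.
      apply ptrans_data_inj in e. symmetry.
      exact (f_equal (fun c => c r s X) e). }
    destruct (pt_inv (pseudonaturalP alpha) X) as [g hg].
    unfold unitary. rewrite eb, (inverse2_unique hg (hbeta r s X)). exact hg.
  - intros hu. unfold ptrans_dual, ptrans_dagger. f_equal.
    extensionality r. extensionality s. extensionality X.
    change (pt_cell (ptrans_dual alpha) X = pt_cell (ptrans_dagger alpha) X).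
    rewrite ptrans_dagger_mate, ptrans_dual_mate. f_equal.
    apply (inverse2_unique (hu r s X)), hbeta.
Qed.
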